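(* Let $(X,r_X)$, $(Y,r_Y)$ be disjoint solutions of the Yang-Baxter equation with a regular pair of ground actions ${}^Y\bullet:Y\times X\to X$, $\bullet^X:Y\times X\to Y$, and let $(Z,r)$ be the corresponding regular extension. Then $(Z,r)$ obeys the Yang-Baxter equation if and only if the following four conditions hold for all $x,y\in X$, $\alpha,\beta\in Y$: $\mathbf{ml1}$: ${}^{\alpha}({}^{\beta}x)={}^{{}^{\alpha}\beta}({}^{\alpha^{\beta}}x)$; $\mathbf{mr1}$: $(\alpha^x)^y=(\alpha^{{}^xy})^{x^y}$; $\mathbf{ml2}$: ${}^{\alpha}(r_X(x,y))=r_X({}^{\alpha}(x,y))$; $\mathbf{mr2}$: $(r_Y(\alpha,\beta))^x=r_Y((\alpha,\beta)^x)$.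
   Context: A solution (braided set) $(X,r_X)$ is a nonempty set $X$ with a bijective map $r_X:X\times X\to X\times X$, written $r_X(x,y)=({}^xy,x^y)$, satisfying the Yang-Baxter equation $r^{12}r^{23}r^{12}=r^{23}r^{12}r^{23}$ on $X^3$ ($r^{12}=r\times\mathrm{id}$, $r^{23}=\mathrm{id}\times r$); similarly $r_Y(\alpha,\beta)=({}^\alpha\beta,\alpha^\beta)$. No involutivity, non-degeneracy or finiteness is assumed. A pair of maps $Y\times X\to X$, $(\alpha,x)\mapsto{}^\alpha x$ and $Y\times X\to Y$, $(\alpha,x)\mapsto\alpha^x$ (ground actions) is regular if the map $\rho:Y\times X\to X\times Y$, $\rho(\alpha,x)=({}^\alpha x,\alpha^x)$ is bijective. The corresponding regular extension is $Z=X\sqcup Y$ with the bijection $r:Z\times Z\to Z\times Z$ given by $r|_{X\times X}=r_X$, $r|_{Y\times Y}=r_Y$, $r|_{Y\times X}=\rho$, $r|_{X\times Y}=\rho^{-1}$. The ground actions are extended by ${}^\alpha(x,y):=({}^\alpha x,{}^{\alpha^x}y)$ and $(\alpha,\beta)^x:=(\alpha^{{}^\beta x},\beta^x)$. *)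

(* Defs.v *)
From mathcomp Require Import ssreflect ssrfun ssrbool.
From mathcomp Require Import boolp.

Set Implicit Arguments.
Unset Strict Implicit.
Unset Printing Implicit Defensive.

Section Braid.
Variables (X : Type) (r : X * X -> X * X).

(* [r (x, y) = (lbr x y, rbr x y)]: these are ${}^x y$ and $x^y$. *)
Definition lbr (x y : X) : X := (r (x, y)).1.
Definition rbr (x y : X) : X := (r (x, y)).2.

(* The cube of X is [X * X * X], i.e. [(X * X) * X]. *)
Definition r12 (t : X * X * X) : X * X * X :=
  let: (x, y, z) := t in (r (x, y), z).

Definition r23 (t : X * X * X) : X * X * X :=
  let: (x, y, z) := t in (x, (r (y, z)).1, (r (y, z)).2).

Definition yang_baxter : Prop := r12 \o r23 \o r12 =1 r23 \o r12 \o r23.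

Definition solution : Prop := [/\ inhabited X, bijective r & yang_baxter].

End Braid.

Section Inverse.
Variables (A B : Type) (f : A -> B) (fbij : bijective f).

Lemma bij_inv_ex : exists2 g : B -> A, cancel f g & cancel g f.
Proof. by case: fbij => g fK gK; exists g. Qed.

(* The inverse map, extracted by choice because [bijective] is a [Prop]. *)
Definition inverse : B -> A := s2val (cid2 bij_inv_ex).

Lemma inverseK : cancel f inverse.
Proof. exact: s2valP (cid2 bij_inv_ex). Qed.

Lemma inverseVK : cancel inverse f.
Proof. exact: s2valP' (cid2 bij_inv_ex). Qed.

End Inverse.

(* Ground actions: [lact a x] is ${}^a x$ and [ract a x] is $a^x$. *)
Section GroundActions.
Variables (X Y : Type) (lact : Y -> X -> X) (ract : Y -> X -> Y).

Definition ground_map (p : Y * X) : X * Y := (lact p.1 p.2, ract p.1 p.2).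

Definition regular : Prop := bijective ground_map.

Definition lact2 (a : Y) (p : X * X) : X * X :=
  (lact a p.1, lact (ract a p.1) p.2).

Definition ract2 (p : Y * Y) (x : X) : Y * Y :=
  (ract p.1 (lact p.2 x), ract p.2 x).

Variables (rX : X * X -> X * X) (rY : Y * Y -> Y * Y) (reg : regular).

(* The disjoint union of X and Y is the sum type [X + Y]. *)
Definition regular_extension (p : (X + Y) * (X + Y)) : (X + Y) * (X + Y) :=
  match p with
  | (inl x, inl y) => let: (x', y') := rX (x, y) in (inl x', inl y')
  | (inr a, inr b) => let: (a', b') := rY (a, b) in (inr a', inr b')
  | (inr a, inl x) => let: (x', a') := ground_map (a, x) in (inl x', inr a')
  | (inl x, inr a) => let: (a', x') := inverse reg (x, a) in (inr a', inl x')
  end.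

Lemma regular_extension_bij :
  bijective rX -> bijective rY -> bijective regular_extension.
Proof.
move=> [gX rXK gXK] [gY rYK gYK].
exists (fun p : (X + Y) * (X + Y) => match p with
  | (inl x, inl y) => let: (x', y') := gX (x, y) in (inl x', inl y')
  | (inr a, inr b) => let: (a', b') := gY (a, b) in (inr a', inr b')
  | (inr a, inl x) => let: (x', a') := ground_map (a, x) in (inl x', inr a')
  | (inl x, inr a) => let: (a', x') := inverse reg (x, a) in (inr a', inl x')
  end).
- move=> [[x|a] [y|b]] /=.
  + by case E: (rX _) => [u v]; rewrite -E rXK.
  + by case E: (inverse _ _) => [u v] /=; have := inverseVK reg (x, b);
      rewrite E => -[-> ->].
  + by have := inverseK reg (a, y); rewrite /ground_map /= => ->.
  + by case E: (rY _) => [u v]; rewrite -E rYK.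
- move=> [[x|a] [y|b]] /=.
  + by case E: (gX _) => [u v] /=; rewrite -E gXK.
  + by case E: (inverse _ _) => [u v] /=; have := inverseVK reg (x, b);
      rewrite E => -[-> ->].
  + by have := inverseK reg (a, y); rewrite /ground_map /= => ->.
  + by case E: (gY _) => [u v] /=; rewrite -E gYK.
Qed.

Definition ml1 : Prop := forall (a b : Y) (x : X),
  lact a (lact b x) = lact (lbr rY a b) (lact (rbr rY a b) x).

Definition mr1 : Prop := forall (a : Y) (x y : X),
  ract (ract a x) y = ract (ract a (lbr rX x y)) (rbr rX x y).

Definition ml2 : Prop := forall (a : Y) (x y : X),
  lact2 a (rX (x, y)) = rX (lact2 a (x, y)).

Definition mr2 : Prop := forall (a b : Y) (x : X),
  ract2 (rY (a, b)) x = rY (ract2 (a, b) x).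

End GroundActions.

(* Main.v *)
(* On Y*X*X the Yang-Baxter equation reads ml2 and mr1, and on Y*Y*X it reads
   ml1 and mr2.  The other mixed triples give nothing new: as rho is bijective,
   every triple in X*Y*X or X*X*Y is reached from Y*X*X by moving the Y entry to
   the right, and since r is involutive on pairs from different components, the
   equation there is equivalent to the one on Y*X*X; similarly for Y*Y*X. *)
Require Import Defs.
From mathcomp Require Import ssreflect ssrfun ssrbool.

Set Implicit Arguments.
Unset Strict Implicit.
Unset Printing Implicit Defensive.

Lemma lbr_rbrE (X : Type) (r : X * X -> X * X) (x y : X) :
  r (x, y) = (lbr r x y, rbr r x y).
Proof. by rewrite /lbr /rbr; case: (r _). Qed.

Section RegularExtension.
Variables (X Y : Type) (rX : X * X -> X * X) (rY : Y * Y -> Y * Y).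
Variables (lact : Y -> X -> X) (ract : Y -> X -> Y) (reg : regular lact ract).

Local Notation r := (regular_extension rX rY reg).

Lemma regular_extension_XX (x y : X) :
  r (inl x, inl y) = (inl (lbr rX x y), inl (rbr rX x y)).
Proof. by rewrite /= lbr_rbrE. Qed.

Lemma regular_extension_YY (a b : Y) :
  r (inr a, inr b) = (inr (lbr rY a b), inr (rbr rY a b)).
Proof. by rewrite /= lbr_rbrE. Qed.

Lemma regular_extension_YX (a : Y) (x : X) :
  r (inr a, inl x) = (inl (lact a x), inr (ract a x)).
Proof. by []. Qed.

(** Stated on values of [ground_map], so that rewriting with it cancels [inverse reg] and the map
    obtained by choice never appears in the computations. *)
Lemma regular_extension_XY (a : Y) (x : X) :
  r (inl (lact a x), inr (ract a x)) = (inr a, inl x).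
Proof. by rewrite /=; have := inverseK reg (a, x); rewrite /ground_map => ->. Qed.

(** Brings an arbitrary pair in X * Y to the form that [regular_extension_XY] can rewrite. *)
Lemma ground_map_surj (x : X) (a : Y) :
  exists b y, x = lact b y /\ a = ract b y.
Proof.
case E: (inverse reg (x, a)) => [b y]; exists b, y.
by have := inverseVK reg (x, a); rewrite E => -[<- <-].
Qed.

Definition regular_extensionE := (regular_extension_XX, regular_extension_YY,
  regular_extension_YX, regular_extension_XY).

(** With [r] kept folded, [/=] only unfolds [r12] and [r23]; each pass of
    [rewrite ?regular_extensionE /=] evaluates one factor of the composites. *)
Local Arguments regular_extension : simpl never.

Local Notation braid_at t :=
  ((r12 r \o r23 r \o r12 r) t = (r23 r \o r12 r \o r23 r) t).

Lemma braid_at_XXX (x y z : X) :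
  yang_baxter rX -> braid_at (inl x, inl y, inl z).
Proof.
move/(_ (x, y, z)); rewrite /= !(lbr_rbrE rX) /= !(lbr_rbrE rX) /=.
by do 3! rewrite ?regular_extensionE /=; move=> -[-> -> ->].
Qed.

Lemma braid_at_YYY (a b c : Y) :
  yang_baxter rY -> braid_at (inr a, inr b, inr c).
Proof.
move/(_ (a, b, c)); rewrite /= !(lbr_rbrE rY) /= !(lbr_rbrE rY) /=.
by do 3! rewrite ?regular_extensionE /=; move=> -[-> -> ->].
Qed.

(** Both sides end in X * X * Y: the two X entries give [ml2] and the Y entry gives [mr1]. *)
Lemma braid_at_YXX (a : Y) (x y : X) :
  braid_at (inr a, inl x, inl y) <->
  lact2 lact ract a (rX (x, y)) = rX (lact2 lact ract a (x, y)) /\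
  ract (ract a x) y = ract (ract a (lbr rX x y)) (rbr rX x y).
Proof.
rewrite /lact2 !lbr_rbrE /=; do 3! rewrite ?regular_extensionE /=.
by split=> [[-> -> ->]|[[-> ->] ->]].
Qed.

Lemma braid_at_YYX (a b : Y) (x : X) :
  braid_at (inr a, inr b, inl x) <->
  lact a (lact b x) = lact (lbr rY a b) (lact (rbr rY a b) x) /\
  ract2 lact ract (rY (a, b)) x = rY (ract2 lact ract (a, b) x).
Proof.
rewrite /ract2 !lbr_rbrE /=; do 3! rewrite ?regular_extensionE /=.
by split=> [[-> -> ->]|[-> [-> ->]]].
Qed.

Section Sufficiency.
Hypotheses (Hml1 : ml1 lact rY) (Hmr1 : mr1 ract rX).
Hypotheses (Hml2 : ml2 lact ract rX) (Hmr2 : mr2 lact ract rY).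

Lemma braid_at_XYX (x : X) (a : Y) (y : X) :
  braid_at (inl x, inr a, inl y).
Proof.
have [b [z [-> ->]]] := ground_map_surj x a.
have := Hml2 b z y; rewrite /lact2 !lbr_rbrE /= => -[e1 e2].
do 3! rewrite ?regular_extensionE /=.
(* The last [r] on the right acts on a pair in X * Y; [ml2] and [mr1] turn that pair into the value
   of [ground_map] at [(ract b (lbr rX z y), rbr rX z y)], where it can be inverted. *)
by rewrite -e1 -e2 Hmr1 !regular_extensionE.
Qed.

Lemma braid_at_XXY (x y : X) (a : Y) :
  braid_at (inl x, inl y, inr a).
Proof.
have [b [y' [-> ->]]] := ground_map_surj y a.
(* The triple now comes from [(c, x', y')] by moving [c] rightwards past [x'] and then past [y']. *)
have [c [x' [-> ->]]] := ground_map_surj x b.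
have := Hml2 c x' y'; rewrite /lact2 !lbr_rbrE /= => -[e1 e2].
do 2! rewrite ?regular_extensionE /=.
rewrite -e1 -e2 Hmr1.
by do 2! rewrite ?regular_extensionE /=.
Qed.

Lemma braid_at_YXY (a : Y) (x : X) (b : Y) :
  braid_at (inr a, inl x, inr b).
Proof.
have [c [z [-> ->]]] := ground_map_surj x b.
have := Hmr2 a c z; rewrite /ract2 !lbr_rbrE /= => -[e1 e2].
do 3! rewrite ?regular_extensionE /=.
(* Here the pair to invert is on the left; by [ml1] and [mr2] it is the value of [ground_map] at
   [(lbr rY a c, lact (rbr rY a c) z)]. *)
by rewrite -e1 -e2 Hml1 !regular_extensionE.
Qed.

Lemma braid_at_XYY (x : X) (a b : Y) :
  braid_at (inl x, inr a, inr b).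
Proof.
have [c [z [-> ->]]] := ground_map_surj x a.
(* The triple now comes from [(c, d, w)] by moving [w] leftwards past [d] and then past [c]. *)
have [d [w [-> ->]]] := ground_map_surj z b.
have := Hmr2 c d w; rewrite /ract2 !lbr_rbrE /= => -[e1 e2].
do 2! rewrite ?regular_extensionE /=.
rewrite -e1 -e2 Hml1.
by do 2! rewrite ?regular_extensionE /=.
Qed.

End Sufficiency.

End RegularExtension.

Theorem theorem4p9 (X Y : Type)
    (rX : X * X -> X * X) (rY : Y * Y -> Y * Y)
    (solX : solution rX) (solY : solution rY)
    (lact : Y -> X -> X) (ract : Y -> X -> Y)
    (reg : regular lact ract) :
  yang_baxter (regular_extension rX rY reg) <->
  [/\ ml1 lact rY, mr1 ract rX, ml2 lact ract rX & mr2 lact ract rY].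
Proof.
case: solX solY => _ _ ybX [_ _ ybY]; split=> [yb|[Hml1 Hmr1 Hml2 Hmr2]].
  split=> [a b x|a x y|a x y|a b x].
  - by case/braid_at_YYX: (yb (inr a, inr b, inl x)).
  - by case/braid_at_YXX: (yb (inr a, inl x, inl y)).
  - by case/braid_at_YXX: (yb (inr a, inl x, inl y)).
  - by case/braid_at_YYX: (yb (inr a, inr b, inl x)).
move=> [[[x|a] [y|b]] [z|c]].
- exact: braid_at_XXX.
- exact: braid_at_XXY.
- exact: braid_at_XYX.
- exact: braid_at_XYY.
- exact/braid_at_YXX.
- exact: braid_at_YXY.
- exact/braid_at_YYX.
- exact: braid_at_YYY.
Qed.
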